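(* Let $p$ be a prime number, let $t\geq 1$, and let $\mathcal{H}_1,\ldots,\mathcal{H}_t$ be finite hypergraphs. Set $\eta=\min_{i\in[t]}\operatorname{ecd}^{p}(\mathcal{H}_i)$. Then for any proper coloring $c$ of the hypergraph $\operatorname{KG}^p(\mathcal{H}_1)\times\cdots\times\operatorname{KG}^p(\mathcal{H}_t)$, this hypergraph contains a colorful (with respect to $c$), balanced, complete $p$-partite subhypergraph with $\eta$ vertices.
   Context: A hypergraph $\mathcal{H}$ consists of a finite vertex set $V(\mathcal{H})$ and a family $E(\mathcal{H})$ of nonempty subsets of $V(\mathcal{H})$ (hyperedges). A proper coloring of a hypergraph is an assignment of colors to vertices with no monochromatic hyperedge. For $r\geq 2$, the general Kneser hypergraph $\operatorname{KG}^r(\mathcal{H})$ is the $r$-uniform hypergraph with vertex set $E(\mathcal{H})$ whose hyperedges are the $r$-sets $\{e_1,\ldots,e_r\}$ of hyperedges of $\mathcal{H}$ that are pairwise disjoint. The categorical product $\mathcal{G}_1\times\cdots\times\mathcal{G}_t$ of hypergraphs has vertex set $V(\mathcal{G}_1)\times\cdots\times V(\mathcal{G}_t)$, and a set $e$ of vertices is a hyperedge iff for every $i\in[t]$ its projection $\pi_i(e)$ onto the $i$-th coordinate is a hyperedge of $\mathcal{G}_i$. An equitable $r$-coloring of a hypergraph is a proper coloring with $r$ colors in which the sizes of any two color classes differ by at most $1$. The equitable $r$-colorability defect $\operatorname{ecd}^r(\mathcal{H})$ is the minimum number of vertices whose removal leaves an induced subhypergraph admitting an equitable $r$-coloring. Given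 a $p$-uniform hypergraph $\mathcal{G}$ with a proper coloring $c$, a ''colorful, balanced, complete $p$-partite subhypergraph with $q$ vertices'' means pairwise disjoint sets $V_1,\ldots,V_p\subseteq V(\mathcal{G})$ with $\sum_i|V_i|=q$, $\big||V_i|-|V_j|\big|\leq 1$ for all $i,j$, every $p$-set containing exactly one vertex from each $V_i$ is a hyperedge of $\mathcal{G}$, and for each $i$ the vertices of $V_i$ receive pairwise distinct colors under $c$. *)

(* Defs.v *)
From HB Require Import structures.
From mathcomp Require Import all_boot.

Set Implicit Arguments.
Unset Strict Implicit.
Unset Printing Implicit Defensive.

Record hypergraph := Hypergraph {
  hvertex :> finType;
  hedges : {set {set hvertex}};
  hedges_neq0 : set0 \notin hedges
}.

Section Colorings.
Variable G : hypergraph.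

Definition monochromatic (C : eqType) (c : G -> C) (e : {set G}) : bool :=
  [forall x in e, forall y in e, c x == c y].

Definition proper_coloring (C : eqType) (c : G -> C) : bool :=
  [forall e in hedges G, ~~ monochromatic c e].

Definition color_class (r : nat) (c : G -> 'I_r) (k : 'I_r) : {set G} :=
  [set x | c x == k].

(* Color classes may be empty. *)
Definition equitable_coloring (r : nat) (c : G -> 'I_r) : bool :=
  proper_coloring c &&
  [forall k, forall l, #|color_class c k| <= #|color_class c l| + 1].

Definition equitably_colorable (r : nat) : bool :=
  [exists c : {ffun G -> 'I_r}, equitable_coloring c].

End Colorings.

Section Induced.
Variables (H : hypergraph) (W : {set H}).

Definition induced_edges : {set {set {x : H | x \in W}}} :=
  [set e : {set {x : H | x \in W}} | [set val x | x in e] \in hedges H].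

Fact induced_edges_neq0 : set0 \notin induced_edges.
Proof. by rewrite inE imset0 (negPf (hedges_neq0 H)). Qed.

Definition induced : hypergraph := Hypergraph induced_edges_neq0.

End Induced.

(* The default [set: H] is always admissible (lemma below), so this is the     *)
(* minimum of #|S| over all S whose removal leaves an equitably r-colorable    *)
(* hypergraph.                                                                 *)
Definition ecd (r : nat) (H : hypergraph) : nat :=
  #|[arg min_(S < [set: H] | equitably_colorable (induced (~: S)) r) #|S| ]|.

Fact equitably_colorable_removeT (r : nat) (H : hypergraph) :
  equitably_colorable (induced (~: [set: H])) r.
Proof.
have noV (x : induced (~: [set: H])) : False.
  by case: x => x; rewrite setCT inE.
have f0 : {ffun induced (~: [set: H]) -> 'I_r}.
  by apply: finfun => x; case: (noV x).
apply/existsP; exists f0; apply/andP; split.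
  apply/forall_inP => e He.
  have e0 : e = set0 by apply/setP => x; case: (noV x).
  by move: He; rewrite e0 (negPf (hedges_neq0 _)).
apply/forallP => k; apply/forallP => l.
by rewrite (_ : color_class f0 k = set0) ?cards0 //; apply/setP => x; case: (noV x).
Qed.

Section Kneser.
Variables (r : nat) (r_gt1 : 1 < r) (H : hypergraph).

Definition kneser_edges : {set {set {e : {set H} | e \in hedges H}}} :=
  [set S : {set {e : {set H} | e \in hedges H}} |
    (#|S| == r) &&
    [forall e in S, forall f in S, (e != f) ==> [disjoint val e & val f]]].

Fact kneser_edges_neq0 : set0 \notin kneser_edges.
Proof. by rewrite inE cards0; case: (r) r_gt1. Qed.

Definition KG : hypergraph := Hypergraph kneser_edges_neq0.

End Kneser.

Section Product.
Variables (t : nat) (t_gt0 : 0 < t) (G : 'I_t -> hypergraph).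

(* Hyperedges of a product of r-uniform hypergraphs may have more than r       *)
(* elements.                                                                   *)
Definition product_edges : {set {set {dffun forall i : 'I_t, G i}}} :=
  [set e : {set {dffun forall i : 'I_t, G i}} |
    [forall i : 'I_t,
      [set v i | v : {dffun forall i : 'I_t, G i} in e] \in hedges (G i)]].

Fact product_edges_neq0 : set0 \notin product_edges.
Proof.
rewrite inE; apply/forallP => /(_ (Ordinal t_gt0)).
by rewrite imset0 (negPf (hedges_neq0 _)).
Qed.

Definition cat_product : hypergraph := Hypergraph product_edges_neq0.

End Product.

Definition colorful_balanced_complete_partite (G : hypergraph) (C : eqType)
    (c : G -> C) (p q : nat) (V : 'I_p -> {set G}) : Prop :=
  [/\ forall i j : 'I_p, i != j -> [disjoint V i & V j],
      \sum_(i < p) #|V i| = q,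
      forall i j : 'I_p, #|V i| <= #|V j| + 1,
      forall e : {set G},
        #|e| = p -> (forall i : 'I_p, #|e :&: V i| = 1) -> e \in hedges G
    & forall i : 'I_p, {in V i &, injective c}].

(* The initial value is itself one of the terms, so this is their minimum. *)
Definition min_ecd (p t : nat) (t_gt0 : 0 < t) (H : 'I_t -> hypergraph) : nat :=
  \big[minn/ecd p (H (Ordinal t_gt0))]_(i < t) ecd p (H i).

(* Main.v *)
Require Import Defs.
From mathcomp Require Import all_boot all_algebra.
From mathcomp Require Import ring zify.

(** Consider the signed vectors X on the disjoint union of the vertex sets, with
    signs in Z/p, ordered by extension.  For every equivariant sign function on
    the nonzero ones there is a chain with one vector per coordinate along which
    consecutive signs differ (a Ky Fan type lemma): otherwise an explicit
    cocycle in the bar complex of Z/p would vanish on the fundamental chain of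
    the subdivided join of copies of Z/p, where it evaluates to 1.

    Contrapositively, a monotone level function which only stays constant along
    X <= Y when an equivariant sign is the same at X and Y must reach the number
    of coordinates.  Here the level of X is built from A_i, the set of signs z
    such that the i-th block of X contains a hyperedge of H_i with all signs z.
    If the A_i have a common element, the level of X is (number of coordinates)
    - eta + (the largest size of a balanced subfamily of the colors of product
    vertices lying in the classes of X).  If they have none, it is the minimum
    of a weight of X and of a bound that strictly increases with the A_i up to
    (number of coordinates) - eta.  Where the bound is active the A_i must
    provide the sign, which they cannot do if each is empty or full; there the
    definition of ecd shows that the weight is within the bound.  A vector of
    large level then carries eta balanced colors.  This needs eta >= p; for
    eta < p, singletons suffice since some part is empty. *)

Set Implicit Arguments.
Unset Strict Implicit.
Unset Printing Implicit Defensive.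

Import GRing.Theory.

(** * Alternating chains of signed vectors *)

Section Cochains.
Local Open Scope ring_scope.
Variables (T : Type) (R : comNzRingType).
Implicit Types (f g : seq T -> R) (xs : seq T) (u : T -> T).

(** The simplicial coboundary, on sequences of all lengths at once. It is augmented: the only face
    of a one-term sequence is [[::]]. *)
Fixpoint cobd f xs : R :=
  if xs is x :: xs' then f xs' - cobd (fun l => f (x :: l)) xs' else 0.

(** The prism operator: the alternating sum over i of f (x_0, ..., x_i, u x_i, ..., u x_k). *)
Fixpoint prism u f xs : R :=
  if xs is x :: xs' then
    f (x :: u x :: map u xs') - prism u (fun l => f (x :: l)) xs'
  else 0.

(** Moving along [u] and then coning off from [v] contracts the complex, for any [u] and [v]; see
    [cone_homotopy]. *)
Definition cone v u f xs : R := f (v :: map u xs) - prism u f xs.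

Lemma eq_cobd f g : f =1 g -> cobd f =1 cobd g.
Proof.
move=> fg xs; elim: xs f g fg => //= x xs IH f g fg.
by rewrite fg (IH _ (fun l => g (x :: l))).
Qed.

Lemma cobd0 xs : cobd (fun _ => 0) xs = 0.
Proof. by elim: xs => //= x xs ->; rewrite subr0. Qed.

Lemma cobdB f g xs : cobd (fun l => f l - g l) xs = cobd f xs - cobd g xs.
Proof.
elim: xs f g => [|x xs IH] f g /=; first by rewrite subr0.
by rewrite IH; ring.
Qed.

Lemma cobd_sum (I : finType) (F : I -> seq T -> R) xs :
  cobd (fun l => \sum_i F i l) xs = \sum_i cobd (F i) xs.
Proof.
elim: xs F => [|x xs IH] F /=; first by rewrite big1.
by rewrite IH sumrB.
Qed.

Lemma cobd_cobd f xs : cobd (cobd f) xs = 0.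
Proof.
elim: xs f => //= x xs IH f.
by rewrite (cobdB f (cobd (fun l => f (x :: l)))) IH subr0 subrr.
Qed.

Lemma eq_prism u f g xs :
    (forall a x b, xs = a ++ x :: b ->
      f (a ++ x :: u x :: map u b) = g (a ++ x :: u x :: map u b)) ->
  prism u f xs = prism u g xs.
Proof.
elim: xs f g => //= x xs IH f g fg.
rewrite (fg [::]) //; congr (_ - _).
by apply: IH => a y b exs; apply: (fg (x :: a)); rewrite exs.
Qed.

Lemma prismB u f g xs :
  prism u (fun l => f l - g l) xs = prism u f xs - prism u g xs.
Proof.
elim: xs f g => [|x xs IH] f g /=; first by rewrite subr0.
by rewrite (IH (fun l => f (x :: l)) (fun l => g (x :: l))); ring.
Qed.

Lemma coneB v u f g xs :
  cone v u (fun l => f l - g l) xs = cone v u f xs - cone v u g xs.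
Proof.
by rewrite /cone prismB; ring.
Qed.

End Cochains.

Lemma cobd_map (T S : Type) (R : comNzRingType) (k : S -> T)
    (f : seq T -> R) xs :
  cobd f (map k xs) = cobd (fun l => f (map k l)) xs.
Proof. by elim: xs f => //= x xs IH f; rewrite IH. Qed.

Section Homotopy.
Local Open Scope ring_scope.
Variables (T : Type) (R : comNzRingType) (u : T -> T).
Implicit Types (f : seq T -> R) (xs : seq T).

Lemma prism_homotopy f xs :
  cobd (prism u f) xs + prism u (cobd f) xs = f (map u xs) - f xs.
Proof.
elim: xs f => [|x xs IH] f /=; first by rewrite addr0 subrr.
rewrite (cobdB (fun l => f (x :: u x :: map u l))
               (prism u (fun l => f (x :: l)))).
rewrite (prismB u f (cobd (fun l => f (x :: l)))) cobd_map.
have /(canRL (addrK _)) -> := IH (fun l => f (x :: l)).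
by ring.
Qed.

Lemma cone_homotopy v f xs :
  cone v u (cobd f) xs = f xs - cobd (cone v u f) xs.
Proof.
rewrite /cone (cobdB (fun l => f (v :: map u l)) (prism u f)) /= cobd_map.
have /(canRL (addrK _)) -> := prism_homotopy f xs.
by ring.
Qed.

End Homotopy.

(** The two faces that drop one of the equal entries cancel, and every other face keeps the
    repetition. *)
Lemma cobd_adjacent (T : Type) (R : comNzRingType) (f : seq T -> R) :
    (forall a y b, f (a ++ y :: y :: b) = 0%R) ->
  forall a y b, cobd f (a ++ y :: y :: b) = 0%R.
Proof.
move=> f0 a y b; elim: a f f0 => [|x a IH] f f0 /=.
  rewrite opprB addrC subrK (eq_cobd (g := fun=> 0%R)) ?cobd0 // => l.
  exact: (f0 [::]).
by rewrite f0 sub0r IH ?oppr0 // => a' y' b'; apply: (f0 (x :: a')).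
Qed.

(** * Twisted cochains over Z/p *)

Section Alternating.
Local Open Scope ring_scope.
Variable q : nat.
Local Notation p := q.+2.
Local Notation Z := 'I_p.

Section Twist.
Variables (T : Type) (act : Z -> T -> T).

(* The twists alternate between g - 1 and the norm 1 + g + ... + g^(p-1), whose
   products vanish. *)
Definition twist (m : nat) (f : seq T -> Z) (xs : seq T) : Z :=
  if m is 0 then f xs else
  if odd m then f (map (act 1) xs) - f xs else \sum_z f (map (act z) xs).

Lemma twistB m f g xs :
  twist m (fun l => f l - g l) xs = twist m f xs - twist m g xs.
Proof.
rewrite /twist; case: m => // m; case: ifP => _; first by ring.
exact: sumrB.
Qed.

Lemma eq_twist m f g xs :
    f xs = g xs -> (forall z, f (map (act z) xs) = g (map (act z) xs)) ->
  twist m f xs = twist m g xs.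
Proof.
move=> fg0 fg; rewrite /twist; case: m => // m; case: ifP => _.
  by rewrite fg fg0.
exact: eq_bigr.
Qed.

Lemma cobd_twist m f xs : cobd (twist m f) xs = twist m (cobd f) xs.
Proof.
rewrite /twist; case: m => // m; case: ifP => _.
  by rewrite (cobdB (fun l => f (map (act 1) l)) f) cobd_map.
rewrite (cobd_sum (fun z l => f (map (act z) l))).
by apply: eq_bigr => z _; rewrite cobd_map.
Qed.

Hypothesis actD : forall y z x, act y (act z x) = act (z + y) x.

Lemma map_actD y z xs : map (act y) (map (act z) xs) = map (act (z + y)) xs.
Proof. by rewrite -map_comp; apply: eq_map => x /=; rewrite actD. Qed.

Lemma sum_act_shift (f : seq T -> Z) y xs :
  \sum_z f (map (act z) (map (act y) xs)) = \sum_z f (map (act z) xs).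
Proof.
rewrite [RHS](reindex_inj (addrI y)) /=.
by apply: eq_bigr => z _; rewrite map_actD.
Qed.

Lemma sum_act_shiftr (f : seq T -> Z) y xs :
  \sum_z f (map (act y) (map (act z) xs)) = \sum_z f (map (act z) xs).
Proof.
rewrite [RHS](reindex_inj (addIr y)) /=.
by apply: eq_bigr => z _; rewrite map_actD.
Qed.

Lemma twist_twist m f xs : (0 < m)%N -> twist m (twist m.+1 f) xs = 0.
Proof.
rewrite /twist; case: m => // m _ /=; case: (odd m) => /=.
  by rewrite sumrB sum_act_shiftr subrr.
by rewrite sum_act_shift subrr.
Qed.

End Twist.

Definition zshift (z x : Z) : Z := x + z.

Lemma zshiftD y z x : zshift y (zshift z x) = zshift (z + y) x.
Proof. by rewrite /zshift addrA. Qed.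

(** A preimage under [twist]. For odd m it is a discrete primitive: the summand of index i is f at
    the translate of [xs] that starts with i. For even m it keeps one sequence of each orbit, the
    one that starts with 0. *)
Definition untwist (m : nat) (f : seq Z -> Z) (xs : seq Z) : Z :=
  if xs is x :: _ then
    if odd m then \sum_(0 <= i < x) f (map (zshift (i%:R - x)) xs)
    else if x == 0 then f xs else 0
  else 0.

(** The m-th cochain lives on sequences of length m. A zigzag: take the coboundary, then a preimage
    under the next twist. *)
Fixpoint sign_cochain (m : nat) : seq Z -> Z :=
  if m is m'.+1 then untwist m (cobd (sign_cochain m'))
  else fun xs => (nilp xs)%:R.

Lemma sum_Zp (F : Z -> Z) : \sum_z F z = \sum_(0 <= i < p) F i%:R.
Proof. by rewrite big_mkord; apply: eq_bigr => i _; rewrite natr_Zp. Qed.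

(** The primitive telescopes; where the shift by 1 wraps from p - 1 to 0, the vanishing norm of f
    closes the sum. *)
Lemma twist_untwist_odd m (f : seq Z -> Z) xs : odd m -> f [::] = 0 ->
  (forall l, \sum_z f (map (zshift z) l) = 0) ->
  twist zshift m (untwist m f) xs = f xs.
Proof.
case: m => // m om f0 Nf; rewrite /twist om.
case: xs => [|x xs] /=; first by rewrite subrr.
move: om => /= ->.
pose F (i : nat) := f (map (zshift (i%:R - x)) (x :: xs)).
have FE (n : nat) : \sum_(0 <= i < n) f (map (zshift (i%:R - zshift 1 x))
    (zshift 1 x :: map (zshift 1) xs)) = \sum_(0 <= i < n) F i.
  apply: eq_bigr => i _; rewrite /F; congr f.
  rewrite -(map_cons (zshift 1)) map_actD; last exact: zshiftD.
  by apply: eq_map => y; rewrite /zshift; ring.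
have Fx : F x = f (x :: xs).
  rewrite /F; congr f; rewrite -[RHS]map_id; apply: eq_map => y.
  by rewrite /zshift natr_Zp subrr addr0.
have ltxp : (x < p)%N := ltn_ord x.
have valx1 : ((x + 1 %% p) %% p = x.+1 %% p)%N by rewrite modnDmr addn1.
rewrite FE -[\sum_(0 <= i < x) _]/(\sum_(0 <= i < x) F i) valx1 -Fx.
case: (ltnP x.+1 p) => x1p.
  by rewrite modn_small // big_nat_recr //=; ring.
have xE : x = q.+1 :> nat by apply/eqP; rewrite -eqSS eqn_leq ltxp.
rewrite xE modnn big_geq // sub0r.
have := Nf (map (zshift (- x)) (x :: xs)).
rewrite sum_Zp big_nat_recr // => /eqP; rewrite addr_eq0 => /eqP FN.
rewrite (eq_bigr (fun i : nat =>
  f (map (zshift i%:R) (map (zshift (- x)) (x :: xs))))).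
  rewrite FN opprK /F; congr f.
  by rewrite map_actD; [apply: eq_map => y; rewrite addrC | exact: zshiftD].
move=> i _; rewrite /F; congr f.
by rewrite map_actD; [apply: eq_map => y; rewrite addrC | exact: zshiftD].
Qed.

Lemma twist_untwist_even m (f : seq Z -> Z) xs :
  (0 < m)%N -> ~~ odd m -> f [::] = 0 ->
  (forall l, f (map (zshift 1) l) = f l) ->
  twist zshift m (untwist m f) xs = f xs.
Proof.
case: m => // m _ om f0 invf1.
have invf z l : f (map (zshift z) l) = f l.
  rewrite -(natr_Zp z); elim: (z : nat) => [|n IH].
    by congr f; rewrite -[RHS]map_id; apply: eq_map => y; rewrite /zshift addr0.
  by rewrite -natr1 -map_actD ?invf1 //; apply: zshiftD.
rewrite /twist (negPf om); case: xs => [|x xs]; first by rewrite big1.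
rewrite /= [~~ odd m](negPf om) -big_mkcond (big_pred1 (- x)) /=.
  exact: (invf (- x) (x :: xs)).
by move=> z; rewrite /zshift addrC addr_eq0.
Qed.

(** Untwisting requires the coboundary to be killed by the previous twist. Twists commute with
    [cobd], so by induction that twist yields a double coboundary. At the start, the norm of an
    invariant cochain is p times it, hence 0 in Z/p. *)
Lemma twist_sign_cochain m xs :
  twist zshift m.+1 (sign_cochain m.+1) xs = cobd (sign_cochain m) xs.
Proof.
elim: m xs => [|m IH] xs.
  apply: twist_untwist_odd => // l.
  rewrite (eq_bigr (fun=> cobd (sign_cochain 0) l)).
    have p0 : p%:R = 0 :> Z := @pchar_Zp p isT.
    by rewrite sumr_const card_ord -mulr_natr p0 mulr0.
  move=> z _; rewrite cobd_map; apply: eq_cobd => l' /=.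
  by rewrite /nilp size_map.
have tw0 l : twist zshift m.+1 (cobd (sign_cochain m.+1)) l = 0.
  by rewrite -cobd_twist (eq_cobd IH) cobd_cobd.
have [om|om] := boolP (odd m.+2).
  apply: twist_untwist_odd => // l; rewrite -[RHS](tw0 l) /twist.
  have -> : odd m.+1 = false by move: om => /=; case: (odd m).
  by [].
apply: twist_untwist_even => // l; apply/eqP.
rewrite -subr_eq0 -[X in _ == X](tw0 l).
by rewrite /twist; have -> : odd m.+1 by move: om => /=; case: (odd m).
Qed.

(** Translation keeps equal neighbours equal, so [untwist] preserves the vanishing that
    [cobd_adjacent] provides. *)
Lemma sign_cochain_adjacent m a y b : sign_cochain m (a ++ y :: y :: b) = 0.
Proof.
elim: m a y b => [|m IH] a y b; first by case: a.
have cobd0 := cobd_adjacent IH.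
have -> : sign_cochain m.+1 = untwist m.+1 (cobd (sign_cochain m)) by [].
have untwistE x l :
    (forall z, cobd (sign_cochain m) (map (zshift z) (x :: l)) = 0) ->
    cobd (sign_cochain m) (x :: l) = 0 ->
    untwist m.+1 (cobd (sign_cochain m)) (x :: l) = 0.
  move=> h1 h2; rewrite /untwist; case: ifP => _; first by rewrite big1.
  by case: ifP.
by case: a => [|x a]; apply: untwistE => [z|]; rewrite -?cat_cons ?map_cat;
  first [exact: (cobd0 [::]) | exact: cobd0].
Qed.

(** * Signed vectors and evaluation on the fundamental chain *)

Section Vectors.
Variable E : finType.
Local Notation svec := {ffun E -> option Z}.
Implicit Types (X Y : svec) (e : E) (es : seq E).

Definition sv0 : svec := [ffun=> None].
Definition sv_shift (z : Z) X : svec := [ffun e => omap (zshift z) (X e)].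
Definition sv_le X Y := [forall e, (X e != None) ==> (Y e == X e)].
Definition sv_set e X : svec := [ffun e' => if e' == e then Some 0 else X e'].

Lemma sv_shiftD y z X : sv_shift y (sv_shift z X) = sv_shift (z + y) X.
Proof.
by apply/ffunP => e; rewrite !ffunE; case: (X e) => //= x; rewrite zshiftD.
Qed.

Lemma sv_leP X Y :
  reflect (forall e x, X e = Some x -> Y e = Some x) (sv_le X Y).
Proof.
apply: (iffP forallP) => [h e x eX | h e].
  by have := h e; rewrite eX /= => /eqP.
by case eX: (X e) => [x|] //=; rewrite (h _ _ eX).
Qed.

Lemma sv_le_shift z X Y : sv_le X Y -> sv_le (sv_shift z X) (sv_shift z Y).
Proof.
move=> /sv_leP h; apply/sv_leP => e x; rewrite !ffunE.
by case eX: (X e) => [w|] //= <-; rewrite (h _ _ eX).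
Qed.

Lemma sv_le_set e X Y : sv_le X Y -> sv_le (sv_set e X) (sv_set e Y).
Proof.
move=> /sv_leP h; apply/sv_leP => e' x; rewrite !ffunE.
by case: eqP => // _ /h.
Qed.

Lemma sv_le_setr e X : X e = None -> sv_le X (sv_set e X).
Proof.
move=> Xe; apply/sv_leP => e' x; rewrite !ffunE.
by case: eqP => // ->; rewrite Xe.
Qed.

Lemma sv_shift_eq0 z X : (sv_shift z X == sv0) = (X == sv0).
Proof.
apply/eqP/eqP => [h|->]; apply/ffunP => e.
  by move/ffunP: h => /(_ e); rewrite !ffunE; case: (X e).
by rewrite !ffunE.
Qed.

Lemma sv_set_neq0 e X : sv_set e X != sv0.
Proof. by apply/eqP => /ffunP /(_ e); rewrite !ffunE eqxx. Qed.

Definition sv_on es X := (X != sv0) && [forall e, (e \in es) || (X e == None)].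

Definition chain es (xs : seq svec) :=
  [&& size xs == size es, all (sv_on es) xs & sorted sv_le xs].

Lemma sv_on_shift z es X : sv_on es X -> sv_on es (sv_shift z X).
Proof.
rewrite /sv_on sv_shift_eq0 => /andP [-> /forallP h]; apply/forallP => e.
by have := h e; rewrite ffunE; case: (X e).
Qed.

Lemma sv_on_set e es X :
  [forall e, (e \in es) || (X e == None)] -> sv_on (e :: es) (sv_set e X).
Proof.
move=> /forallP h; rewrite /sv_on sv_set_neq0; apply/forallP => e'.
by rewrite ffunE inE; case: eqP => //= _; apply: h.
Qed.

Lemma sv_on_cons e es X : sv_on es X -> sv_on (e :: es) X.
Proof.
rewrite /sv_on => /andP [-> /forallP h]; apply/forallP => e'.
by rewrite inE -orbA h orbT.
Qed.

Lemma chain_shift z es xs : chain es xs -> chain es (map (sv_shift z) xs).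
Proof.
case/and3P => sz /allP on srt; apply/and3P; split; first by rewrite size_map.
  by rewrite all_map; apply/allP => X /on; apply: sv_on_shift.
by apply: homo_sorted srt => X Y; apply: sv_le_shift.
Qed.

Lemma chain_set e es xs :
  chain es xs -> chain (e :: es) (sv_set e sv0 :: map (sv_set e) xs).
Proof.
case/and3P => sz /allP on srt; apply/and3P; split=> /=.
- by rewrite size_map eqSS.
- rewrite sv_on_set; last by apply/forallP => e'; rewrite ffunE orbT.
  by rewrite all_map; apply/allP => X /on /andP [_]; apply: sv_on_set.
- have: sorted sv_le (sv0 :: xs).
    case: xs {sz on} srt => //= X xs ->; rewrite andbT.
    by apply/sv_leP => e' x; rewrite ffunE.
  by move=> /(homo_sorted (@sv_le_set e)).
Qed.

(** [X] is zero at [e], so [sv_set e X] lies above it, and the prism over a chain consists of chains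
    with one more coordinate. *)
Lemma chain_prism e es a X b : e \notin es -> chain es (a ++ X :: b) ->
  chain (e :: es) (a ++ X :: sv_set e X :: map (sv_set e) b).
Proof.
move=> ees /and3P [/eqP sz on srt]; apply/and3P; split.
- by rewrite /= -sz !size_cat /= size_map addnS.
- move: on; rewrite !all_cat /= => /and3P [ona onX onb].
  have onU: forall Y, sv_on es Y -> sv_on (e :: es) (sv_set e Y).
    by move=> Y /andP [_]; apply: sv_on_set.
  rewrite sv_on_cons // onU // all_map.
  rewrite (sub_all _ ona) /=; last by move=> Y; apply: sv_on_cons.
  by rewrite (sub_all _ onb) /=.
- have Xe : X e = None.
    have /(allP on)/andP [_ /forallP/(_ e)]: X \in a ++ X :: b.
      by rewrite mem_cat inE eqxx orbT.
    by rewrite (negPf ees) => /eqP.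
  move: srt; rewrite !sorted_cat_cons => /andP [-> pb] /=.
  rewrite sv_le_setr //=.
  by apply: (homo_path (f := sv_set e)) pb => Y W; apply: sv_le_set.
Qed.

(** Evaluation on the fundamental chain, which is never built. Passing from [es] to [e :: es], that
    chain is twisted and then coned off from the vector whose only sign is 0 at [e]; here the dual
    operators act on f. *)
Fixpoint integ es (f : seq svec -> Z) : Z :=
  if es is e :: es' then
    integ es' (twist sv_shift (size es') (cone (sv_set e sv0) (sv_set e) f))
  else f [::].

(** Cones, prisms and shifts only lead from chains to chains, so values of f elsewhere do not
    matter. *)
Lemma eq_integ es f g : uniq es -> (forall xs, chain es xs -> f xs = g xs) ->
  integ es f = integ es g.
Proof.
elim: es f g => [|e es IH] f g /=; first by move=> _; apply.
case/andP => ees ues fg; apply: IH => // xs cxs.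
have conefg ys : chain es ys -> cone (sv_set e sv0) (sv_set e) f ys =
    cone (sv_set e sv0) (sv_set e) g ys.
  move=> cys; rewrite /cone fg; last exact: chain_set.
  congr (_ - _); apply: eq_prism => a X b eys; apply: fg.
  by apply: chain_prism => //; rewrite -eys.
by apply: eq_twist => [|z]; apply: conefg => //; apply: chain_shift.
Qed.

Lemma integB es f g :
  uniq es -> integ es (fun l => f l - g l) = integ es f - integ es g.
Proof.
elim: es f g => //= e es IH f g /andP [_ ues]; rewrite -IH //.
apply: eq_integ => // xs _; rewrite -twistB.
by apply: eq_twist => [|z]; apply: coneB.
Qed.

Lemma integ0 es : uniq es -> integ es (fun _ => 0) = 0.
Proof.
by move=> ues; rewrite -[RHS](subrr (integ es (fun=> 0))) -integB // subrr.
Qed.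

Lemma integ_twist_twist es f : uniq es ->
  integ es (twist sv_shift (size es) (twist sv_shift (size es).+1 f)) = 0.
Proof.
case: es => [|e es] ues; first by rewrite /= /twist subrr.
rewrite -[RHS](integ0 ues); apply: eq_integ => // xs _.
by apply: twist_twist => //; apply: sv_shiftD.
Qed.

(** Stokes: the boundary of the chain on [e :: es] is the twisted chain on [es]. By [cone_homotopy]
    there is one other term, which by induction is a product of two consecutive twists and
    vanishes. *)
Lemma integ_cobd e es f : uniq (e :: es) ->
  integ (e :: es) (cobd f) = integ es (twist sv_shift (size es) f).
Proof.
elim: es e f => [|e' es IH] e f ues.
  by rewrite /= /twist /cone /= !subr0.
have ues' : uniq (e' :: es) by case/andP: ues.
pose m := (size es).+1; pose K := @cone _ Z (sv_set e sv0) (sv_set e).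
rewrite -[LHS]/(integ (e' :: es) (twist sv_shift m (K (cobd f)))).
transitivity (integ (e' :: es) (fun l =>
    twist sv_shift m f l - cobd (twist sv_shift m (K f)) l)).
  apply: eq_integ => // xs _; rewrite cobd_twist -twistB.
  by apply: eq_twist => [|z]; apply: cone_homotopy.
rewrite integB // IH // integ_twist_twist ?subr0 //.
by case/andP: ues'.
Qed.

Variable s : svec -> Z.
Hypothesis s_shift : forall z X, X != sv0 -> s (sv_shift z X) = s X + z.

(** Stokes turns the coboundary of the cochain of degree m + 1 into its twist, which is the
    coboundary of the cochain of degree m; the descent ends with the value 1. Equivariance of [s]
    carries shifts of vectors to shifts of signs. *)
Lemma integ_sign_cochain e es : uniq (e :: es) ->
  integ (e :: es) (fun xs => cobd (sign_cochain (size es)) (map s xs)) = 1.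
Proof.
elim: es e => [|e' es IH] e ues; first by rewrite /= /twist /cone /= !subr0.
have ues' : uniq (e' :: es) by case/andP: ues.
rewrite -[RHS](IH e' ues').
transitivity (integ [:: e, e' & es]
    (cobd (fun xs => sign_cochain (size es).+1 (map s xs)))).
  by apply: eq_integ => // xs _; rewrite cobd_map.
rewrite integ_cobd //; apply: eq_integ => // xs cxs.
rewrite -twist_sign_cochain.
have shE z : map s (map (sv_shift z) xs) = map (zshift z) (map s xs).
  rewrite -!map_comp; apply/eq_in_map => X Xxs /=; apply: s_shift.
  by case/and3P: cxs => _ /allP /(_ _ Xxs) /andP [].
rewrite /twist /=; case: ifP => _; first by rewrite shE.
by apply: eq_bigr => z _; rewrite shE.
Qed.

(** If every full chain has two equal consecutive signs, the cocycle vanishes on all of them,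
    against the value 1 of its integral. *)
Theorem alternating_chain : (0 < #|E|)%N ->
  ~ (forall xs, size xs = #|E| -> all (fun X => X != sv0) xs ->
       sorted sv_le xs -> ~~ sorted (fun X Y => s X != s Y) xs).
Proof.
move=> E_gt0 noalt.
have [e [es eE]] : exists e, exists es, enum E = e :: es.
  by move: E_gt0; rewrite cardE; case: (enum E) => // e es _; exists e, es.
have ues : uniq (e :: es) by rewrite -eE enum_uniq.
have := integ_sign_cochain ues.
rewrite (@eq_integ _ _ (fun _ => 0)) //.
  by rewrite integ0 // => /eqP; rewrite eq_sym oner_eq0.
move=> xs /and3P [/eqP sz on srt].
have {}on : all (fun X => X != sv0) xs by apply: sub_all on => X /andP [].
have /noalt/(_ on srt) : size xs = #|E| by rewrite sz -eE cardE.
have not_sorted (l : seq svec) : ~~ sorted (fun X Y => s X != s Y) l ->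
    exists a y b, map s l = a ++ y :: y :: b.
  case: l => //= X l; elim: l X => //= Y l IH X.
  rewrite negb_and negbK => /orP [/eqP -> | /IH [a [y [b ->]]]].
    by exists [::], (s Y), (map s l).
  by exists (s X :: a), y, b.
case/not_sorted => a [y [b ->]].
by apply: cobd_adjacent => a' y' b'; apply: sign_cochain_adjacent.
Qed.

End Vectors.
End Alternating.

(** * Balanced levels of families of sets *)

Lemma exists_subset_card (U : finType) (A : {set U}) k :
  k <= #|A| -> exists2 B : {set U}, B \subset A & #|B| = k.
Proof.
move=> kA; exists [set x in take k (enum A)].
  by apply/subsetP => x; rewrite inE => /mem_take; rewrite mem_enum.
rewrite cardsE (card_uniqP _) ?take_uniq ?enum_uniq //.
rewrite size_take -cardE; case: ltnP => // ?.
by apply/eqP; rewrite eqn_leq kA andbT.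
Qed.

Section Families.
Variable q : nat.
Local Notation p := q.+2.
Local Notation Z := 'I_p.

Section OneFamily.
Variable U : finType.
Local Notation family := {ffun Z -> {set U}}.
Implicit Types F G : family.

Definition fam_min F := #|F [arg min_(z < (0 : Z)%R) #|F z|]|.
Definition fam_top F : {set Z} := [set z | fam_min F < #|F z|].

(* The largest total size of a subfamily whose sizes differ by at most one. *)
Definition level F := fam_min F * p + #|fam_top F|.
Definition fam_sub F G := forall z, F z \subset G z.
Definition fam_size F := \sum_z #|F z|.

(* The part of F that stays constant while F grows at a fixed level. *)
Definition code F : family :=
  if fam_top F == set0 then F
  else [ffun z => if z \in fam_top F then [set: U] else set0].

Definition fam_shift (y : Z) F : family := [ffun z => F (z - y)%R].

Lemma fam_min_le F z : fam_min F <= #|F z|.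
Proof. by rewrite /fam_min; case: arg_minnP => // i _ /(_ z); apply. Qed.

Lemma fam_min_ex F : exists z, #|F z| = fam_min F.
Proof. by exists [arg min_(z < (0 : Z)%R) #|F z|]. Qed.

Lemma fam_minP F m : (forall z, m <= #|F z|) -> m <= fam_min F.
Proof. by move=> h; have [z <-] := fam_min_ex F. Qed.

Lemma fam_top_proper F : exists z, z \notin fam_top F.
Proof. by have [z hz] := fam_min_ex F; exists z; rewrite inE hz ltnn. Qed.

Lemma card_fam_top F : #|fam_top F| < p.
Proof.
rewrite -[p in _ < p]card_ord ltn_neqAle max_card andbT.
apply/negP => /eqP full; have [z] := fam_top_proper F.
suff -> : fam_top F = setT by rewrite inE.
by apply/eqP; rewrite eqEcard subsetT cardsT full /=.
Qed.

Lemma fam_min_sub F G : fam_sub F G -> fam_min F <= fam_min G.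
Proof.
move=> FG; apply: fam_minP => z; apply: leq_trans (fam_min_le F z) _.
exact: subset_leq_card.
Qed.

Lemma fam_top_sub F G : fam_sub F G -> fam_min F = fam_min G ->
  fam_top F \subset fam_top G.
Proof.
move=> FG eFG; apply/subsetP => z; rewrite !inE eFG => h.
by apply: leq_trans h _; apply: subset_leq_card.
Qed.

Lemma level_mono F G : fam_sub F G -> level F <= level G.
Proof.
move=> FG; rewrite /level.
have := fam_min_sub FG; rewrite leq_eqVlt => /orP [/eqP e|lt].
  by rewrite -e leq_add2l; apply/subset_leq_card/fam_top_sub.
by have := card_fam_top F; nia.
Qed.

(** Since [fam_top] has fewer than p elements, the level determines [fam_min] and [fam_top] by
    division by p. If no class exceeds the minimum, all classes of F and G have the same size and
    agree. *)
Lemma level_rigid F G : fam_sub F G -> level F = level G -> code F = code G.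
Proof.
move=> FG; rewrite /level => eL.
have eM : fam_min F = fam_min G.
  have := fam_min_sub FG; have := card_fam_top F; have := card_fam_top G.
  by move: eL; nia.
have eT : fam_top F = fam_top G.
  apply/eqP; rewrite eqEcard fam_top_sub //=.
  by move: eL; rewrite eM => /eqP; rewrite eqn_add2l => /eqP ->.
rewrite /code -eT; case: eqP => // T0.
apply/ffunP => z; apply/eqP; rewrite eqEcard FG /=.
apply: leq_trans (fam_min_le F z); rewrite eM leqNgt.
by have := in_set0 z; rewrite -T0 eT inE => ->.
Qed.

Lemma fam_shiftD y z F : fam_shift y (fam_shift z F) = fam_shift (z + y)%R F.
Proof. by apply/ffunP => x; rewrite !ffunE; congr (F _); ring. Qed.

Lemma fam_shift0 F : fam_shift 0%R F = F.
Proof. by apply/ffunP => x; rewrite !ffunE subr0. Qed.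

Lemma fam_min_shift y F : fam_min (fam_shift y F) = fam_min F.
Proof.
apply/eqP; rewrite eqn_leq; apply/andP; split; apply: fam_minP => z.
  by have := fam_min_le (fam_shift y F) (z + y)%R; rewrite ffunE addrK.
by rewrite ffunE fam_min_le.
Qed.

Lemma mem_fam_top_shift y F z :
  (z \in fam_top (fam_shift y F)) = ((z - y)%R \in fam_top F).
Proof. by rewrite !inE fam_min_shift ffunE. Qed.

Lemma fam_size_shift y F : fam_size (fam_shift y F) = fam_size F.
Proof.
rewrite /fam_size [RHS](reindex_inj (addIr (- y)%R)) /=.
by apply: eq_bigr => z _; rewrite ffunE.
Qed.

Lemma card_shift_set (y : Z) (A B : {set Z}) :
  (forall z, (z \in A) = ((z - y)%R \in B)) -> #|A| = #|B|.
Proof.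
move=> h; rewrite -(card_imset (mem A) (addIr (- y)%R)).
apply: eq_card => z; apply/imsetP/idP => [[w wA ->]|zB]; first by rewrite -h.
by exists (z + y)%R; rewrite ?addrK // h addrK.
Qed.

Lemma level_shift y F : level (fam_shift y F) = level F.
Proof.
rewrite /level fam_min_shift; congr (_ + _).
exact: (card_shift_set (mem_fam_top_shift y F)).
Qed.

Lemma code_shift y F : code (fam_shift y F) = fam_shift y (code F).
Proof.
rewrite /code -cards_eq0 (card_shift_set (mem_fam_top_shift y F)) cards_eq0.
case: ifP => // _; apply/ffunP => z.
by rewrite !ffunE mem_fam_top_shift.
Qed.

Lemma set_shift_fixed (A : {set Z}) :
    (forall z, ((z - 1)%R \in A) = (z \in A)) ->
  forall y z, (y \in A) = (z \in A).
Proof.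
move=> h; suff h0 z : (z \in A) = (0%R \in A) by move=> y z; rewrite h0 [RHS]h0.
rewrite -(natr_Zp z); elim: (z : nat) => // n IH.
by rewrite -natr1 -h addrK IH.
Qed.

(** [fam_top] never contains all signs, so if it is nonempty it is not invariant under the shift,
    and neither is the code. If it is empty, the code is F itself. *)
Lemma code_fixed F : fam_shift 1%R (code F) = code F -> fam_shift 1%R F = F.
Proof.
rewrite /code; case: eqP => // /eqP /set0Pn [z zT] /ffunP h.
(* A nonempty [U] makes the two values that [code] takes different. *)
have U0 : [set: U] != set0.
  move: zT; rewrite inE -card_gt0 cardsT => zT.
  exact: leq_trans (leq_ltn_trans (leq0n _) zT) (max_card _).
have inv z' : ((z' - 1)%R \in fam_top F) = (z' \in fam_top F).
  have := h z'; rewrite !ffunE.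
  case: ifP; case: ifP => // _ _ /eqP; rewrite ?(negPf U0) //.
  by rewrite eq_sym (negPf U0).
have [w] := fam_top_proper F.
by rewrite (set_shift_fixed inv w z) zT.
Qed.

Lemma fam_size_sub F G : fam_sub F G -> fam_size F <= fam_size G.
Proof. by move=> FG; apply: leq_sum => z _; apply: subset_leq_card. Qed.

Lemma fam_size_rigid F G : fam_sub F G -> fam_size F = fam_size G -> F = G.
Proof.
move=> FG eFG; apply/ffunP => z; apply/eqP.
have [//|ne] := eqVneq (F z) (G z).
suff: fam_size F < fam_size G by rewrite eFG ltnn.
rewrite /fam_size (bigD1 z) //= [X in _ < X](bigD1 z) //= -addSn leq_add //.
  by apply: proper_card; rewrite properEneq ne FG.
by apply: leq_sum => w _; apply: subset_leq_card.
Qed.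

Lemma level_le_size F : level F <= fam_size F.
Proof.
rewrite /level /fam_size -sum1_card big_mkcond /=.
rewrite mulnC -[p in p * _]card_ord -sum_nat_const -big_split /=.
apply: leq_sum => z _; case: ifP; rewrite ?inE ?addn1 // addn0 => _.
exact: fam_min_le.
Qed.

Lemma level_gt0 F z : F z != set0 -> 0 < level F.
Proof.
move=> Fz; rewrite /level; have [m0|] := posnP (fam_min F); last by lia.
rewrite addn_gt0 card_gt0; apply/orP; right.
by apply/set0Pn; exists z; rewrite inE m0 card_gt0.
Qed.

(** Take u elements of every class, and one more in v classes that have more than u. If u is the
    minimum, [fam_top] offers v such classes; if u is smaller, all classes qualify. *)
Lemma balanced_subfamily F n : n <= level F ->
  exists G, [/\ fam_sub G F, fam_size G = n & forall y z, #|G y| <= #|G z| + 1].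
Proof.
move=> nF; pose u := n %/ p; pose v := n %% p.
have nE : n = u * p + v by rewrite -divn_eq.
have ltvp : v < p by rewrite ltn_mod.
have [uh vle] : u <= fam_min F /\ v <= #|[set z | u < #|F z|]|.
  have := card_fam_top F; move: nF; rewrite nE /level => nF ltp.
  have uh : u <= fam_min F by nia.
  split=> //; move: uh; rewrite leq_eqVlt => /orP [/eqP uE|uh].
    by rewrite uE -/(fam_top F); move: nF; rewrite uE leq_add2l.
  have -> : [set z | u < #|F z|] = setT.
    by apply/setP => z; rewrite !inE (leq_trans uh) // fam_min_le.
  by rewrite cardsT card_ord ltnW.
have [B /subsetP BF cB] := exists_subset_card vle.
have sub z : exists A : {set U}, (A \subset F z) && (#|A| == u + (z \in B)).
  have [|A AF cA] := @exists_subset_card _ (F z) (u + (z \in B)).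
    have [/BF|_] := boolP (z \in B); first by rewrite inE addn1.
    by rewrite addn0 (leq_trans uh) ?fam_min_le.
  by exists A; rewrite AF cA eqxx.
pose G : family := [ffun z => xchoose (sub z)].
have GE z : G z \subset F z /\ #|G z| = u + (z \in B).
  by rewrite ffunE; have /andP [-> /eqP ->] := xchooseP (sub z).
exists G; split.
- by move=> z; have [] := GE z.
- rewrite /fam_size nE (eq_bigr (fun z => u + (z \in B))) => [|z _];
    last by have [] := GE z.
  rewrite big_split /= sum_nat_const card_ord mulnC; congr (_ + _).
  rewrite -cB -sum1_card [RHS]big_mkcond.
  by apply: eq_bigr => z _; case: (z \in B).
- move=> y z; have [_ ->] := GE y; have [_ ->] := GE z.
  by case: (y \in B); case: (z \in B); lia.
Qed.

Hypothesis p_prime : prime p.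

(** As p is prime, y is invertible, and the shift by 1 is the iterate of order [y^-1] of the shift
    by y. *)
Lemma fam_shift_fixed y F :
  y != 0%R -> fam_shift y F = F -> fam_shift 1%R F = F.
Proof.
move=> y0 fF.
have fk k : fam_shift (y *+ k)%R F = F.
  elim: k => [|k IH]; first by rewrite mulr0n fam_shift0.
  by rewrite mulrSr -fam_shiftD IH.
have yu : (y \is a GRing.unit)%R.
  have := @unitZpE p y isT; rewrite natr_Zp => ->.
  rewrite prime_coprime // gtnNdvd ?ltn_ord // lt0n.
  by apply: contra y0 => /eqP y0; apply/eqP/val_inj.
by have := fk (y^-1)%R; rewrite -mulr_natr natr_Zp mulrV.
Qed.

(** Each orbit gets a representative, and the sign of F is the shift that leads from there to F. It
    is unique for F that is not fixed, by [fam_shift_fixed]. *)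
Lemma fam_sign : exists sgn : family -> Z, forall y F,
  fam_shift 1%R F <> F -> sgn (fam_shift y F) = (sgn F + y)%R.
Proof.
pose rep F := odflt F [pick G | [exists z, fam_shift z G == F]].
have repE F : exists z, fam_shift z (rep F) = F.
  rewrite /rep; case: pickP => [G /existsP [z /eqP]|_] /=; first by exists z.
  by exists 0%R; apply: fam_shift0.
(* The predicate under [pick] describes the orbit of F, so all members of the orbit pick the same
   family. *)
have rep_shift y F : rep (fam_shift y F) = rep F.
  rewrite /rep (@eq_pick _ _ (fun G => [exists z, fam_shift z G == F])).
    case: pickP => // /(_ F) /existsP []; exists 0%R.
    by rewrite fam_shift0.
  move=> G; apply/existsP/existsP => [[z /eqP e]|[z /eqP e]].
    by exists (z - y)%R; rewrite -fam_shiftD e fam_shiftD subrr fam_shift0.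
  by exists (z + y)%R; rewrite -fam_shiftD e.
pose sgn F := odflt 0%R [pick z | fam_shift z (rep F) == F].
have sgnE F : fam_shift (sgn F) (rep F) = F.
  rewrite /sgn; case: pickP => [z /eqP //|h].
  by have [z hz] := repE F; have := h z; rewrite hz eqxx.
exists sgn => y F nF; apply/eqP; rewrite -subr_eq0; apply/negPn/negP => ne.
apply: nF; apply: (fam_shift_fixed ne).
set a := sgn (fam_shift y F).
suff: fam_shift (a - (sgn F + y))%R (fam_shift (sgn F) (rep F)) = F.
  by rewrite sgnE.
rewrite fam_shiftD -(rep_shift y F).
have -> : (sgn F + (a - (sgn F + y)) = a - y)%R by ring.
by rewrite -fam_shiftD sgnE fam_shiftD subrr fam_shift0.
Qed.

End OneFamily.
End Families.

(** * Level functions on signed vectors *)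

Section LevelChain.
Variables (q : nat) (E : finType).
Local Notation svec := {ffun E -> option 'I_q.+2}.

(** Along an alternating chain no step keeps the level, so it starts at 1 or more and rises at each
    of the [#|E| - 1] steps. *)
Lemma exists_high_level (s : svec -> 'I_q.+2) (lev : svec -> nat) :
    0 < #|E| ->
    (forall z X, X != sv0 q E -> s (sv_shift z X) = (s X + z)%R) ->
    (forall X, X != sv0 q E -> 0 < lev X) ->
    (forall X Y, X != sv0 q E -> sv_le X Y ->
       lev X <= lev Y /\ (lev X = lev Y -> s X = s Y)) ->
  exists2 X : svec, X != sv0 q E & #|E| <= lev X.
Proof.
move=> E_gt0 s_shift lev_gt0 lev_le.
have [/existsP [X /andP [X0 hX]]|] :=
  boolP [exists X : svec, (X != sv0 q E) && (#|E| <= lev X)]; first by exists X.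
move=> /existsPn no; exfalso; apply: (alternating_chain s_shift E_gt0).
case=> [|X xs] sz nz srt; first by move: sz E_gt0 => /= <-.
apply/negP => alt.
have grow Y l : all (fun X => X != sv0 q E) (Y :: l) -> path (@sv_le q E) Y l ->
    path (fun X Y => s X != s Y) Y l -> lev Y + size l <= lev (last Y l).
  elim: l Y => [|W l IH] Y /=; first by rewrite addn0.
  case/and3P => Y0 W0 nl /andP [YW pl] /andP [sYW al].
  have [leYW rig] := lev_le _ _ Y0 YW.
  have : lev Y != lev W by apply: contra sYW => /eqP/rig ->.
  have := IH W; rewrite /= W0 nl => /(_ isT pl al); lia.
have lastnz : last X xs != sv0 q E by apply: (allP nz); apply: mem_last.
have := no (last X xs); rewrite lastnz /= -ltnNge.
have := grow X xs nz srt alt; have := lev_gt0 X.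
by case/andP: nz => -> _ /(_ isT); rewrite -sz /=; lia.
Qed.

End LevelChain.

(** * Equitable colorability defect *)

Lemma ecd_le r (H : hypergraph) (S : {set H}) :
  equitably_colorable (induced (~: S)) r -> ecd r H <= #|S|.
Proof.
move=> hS; rewrite /ecd; case: arg_minnP => [|S' _]; last exact.
exact: equitably_colorable_removeT.
Qed.

Section OneHypergraph.
Variable q : nat.
Local Notation p := q.+2.
Local Notation Z := 'I_p.
Variable H : hypergraph.
Local Notation family := {ffun Z -> {set H}}.
Implicit Types F G : family.

Definition fam_disjoint F := forall y z, y != z -> [disjoint F y & F z].

Definition edge_signs F : {set Z} :=
  [set z | [exists e in hedges H, e \subset F z]].

Lemma fam_disjoint_eq F x y z :
  fam_disjoint F -> x \in F y -> x \in F z -> y = z.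
Proof.
move=> dF xy xz; apply/eqP; apply: contraTT xz => ne.
by rewrite (disjointFr (dF _ _ ne) xy).
Qed.

Definition fam_color F x : Z := odflt 0%R [pick z | x \in F z].

Lemma fam_colorE F x z : fam_disjoint F -> x \in F z -> fam_color F x = z.
Proof.
move=> dF xz; rewrite /fam_color.
case: pickP => [w xw|/(_ z)]; last by rewrite xz.
exact: fam_disjoint_eq xz.
Qed.

Lemma card_fam_disjoint F :
  fam_disjoint F -> #|\bigcup_z F z| = fam_size F.
Proof.
move=> dF; have colE x z : x \in F z -> fam_color F x = z.
  exact: fam_colorE.
rewrite -sum1_card (partition_big (fam_color F) predT) //=.
apply: eq_bigr => z _.
rewrite -sum1_card; apply: eq_bigl => x; apply/andP/idP => [[]|xz].
  by case/bigcupP => w _ xw /eqP <-; rewrite (colE _ _ xw).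
by split; [apply/bigcupP; exists z | rewrite (colE _ _ xz)].
Qed.

Lemma fam_size_le F : fam_disjoint F -> fam_size F <= #|H|.
Proof. by move=> dF; rewrite -card_fam_disjoint // max_card. Qed.

(** The classes of F color their union equitably, and properly since none contains a hyperedge; so
    removing all other vertices is admissible in [ecd]. *)
Lemma ecd_balanced_family F :
    fam_disjoint F -> (forall y z, #|F y| <= #|F z| + 1) ->
    edge_signs F = set0 ->
  fam_size F + ecd p H <= #|H|.
Proof.
move=> dF bF eF; pose W := \bigcup_z F z.
have cW : #|W| = fam_size F := card_fam_disjoint dF.
have colE x z : x \in F z -> fam_color F x = z by exact: fam_colorE.
have colW x : x \in W -> x \in F (fam_color F x).
  by case/bigcupP => z _ xz; rewrite (colE _ _ xz).
suff: ecd p H <= #|~: W| by rewrite -cW -(cardsC W) leq_add2l.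
apply: ecd_le.
(* The removed set is [~: W], and [induced] is taken on its complement. *)
pose c : {ffun induced (~: ~: W) -> Z} := [ffun x => fam_color F (val x)].
have inW (x : induced (~: ~: W)) : val x \in W.
  by case: x => x /=; rewrite setCK.
have cclass k : #|color_class c k| = #|F k|.
  rewrite -(card_imset _ val_inj); apply: eq_card => x.
  apply/imsetP/idP => [[y]|xk].
    by rewrite inE ffunE => /eqP <- ->; exact/colW/inW.
  have xW : x \in ~: ~: W by rewrite setCK; apply/bigcupP; exists k.
  by exists (Sub x xW) => //; rewrite inE ffunE /= (colE _ _ xk).
apply/existsP; exists c; apply/andP; split; last first.
  by apply/forallP => k; apply/forallP => l; rewrite !cclass.
apply/forall_inP => e; rewrite inE => eH; apply/negP => mono.
have [e0|[x xe]] := set_0Vmem e.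
  by move: eH; rewrite e0 imset0 (negPf (hedges_neq0 H)).
have: fam_color F (val x) \in edge_signs F.
  rewrite inE; apply/existsP; exists [set val y | y in e]; rewrite eH /=.
  apply/subsetP => _ /imsetP [y ye ->].
  move/forall_inP: mono => /(_ _ ye) /forall_inP /(_ _ xe).
  by rewrite !ffunE => /eqP <-; exact/colW/inW.
by rewrite eF inE.
Qed.

Lemma edge_signs_sub F G : fam_sub F G -> edge_signs F \subset edge_signs G.
Proof.
move=> FG; apply/subsetP => z; rewrite !inE => /existsP [e /andP [eH eF]].
by apply/existsP; exists e; rewrite eH (subset_trans eF).
Qed.

Lemma mem_edge_signs_shift y F z :
  (z \in edge_signs (fam_shift y F)) = ((z - y)%R \in edge_signs F).
Proof. by rewrite !inE ffunE. Qed.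

Lemma level_edge_free F :
  fam_disjoint F -> edge_signs F = set0 -> level F + ecd p H <= #|H|.
Proof.
move=> dF eF; have [G [GF <- bG]] := balanced_subfamily (leqnn (level F)).
apply: ecd_balanced_family => //.
  by move=> y z /dF; apply: disjointW.
by apply/eqP; rewrite -subset0 -eF edge_signs_sub.
Qed.

Lemma exists_equitable_family (W : {set H}) n : n <= #|W| ->
  exists F, [/\ fam_disjoint F, forall z, F z \subset W, fam_size F = n &
    forall y z, #|F y| <= #|F z| + 1].
Proof.
elim: n => [|n IH] nW.
  exists [ffun=> set0]; split.
  - by move=> y z _; rewrite ffunE -setI_eq0 set0I.
  - by move=> z; rewrite ffunE sub0set.
  - by rewrite /fam_size big1 // => z _; rewrite ffunE cards0.
  - by move=> y z; rewrite !ffunE cards0.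
have [F [dF FW sF bF]] := IH (ltnW nW).
have [x xW xF] : exists2 x, x \in W & x \notin \bigcup_z F z.
  apply/subsetPn/negP => /subset_leq_card.
  by rewrite card_fam_disjoint // sF leqNgt nW.
have {}xF z : x \notin F z by apply: contra xF => xz; apply/bigcupP; exists z.
have [z0 hz0] := fam_min_ex F.
pose G : family := [ffun z => if z == z0 then x |: F z else F z].
have cG z : #|G z| = (z == z0) + #|F z|.
  by rewrite ffunE; case: eqP => // _; rewrite cardsU1 xF.
exists G; split.
- move=> y z ne; rewrite !ffunE.
  case: (altP (y =P z0)) => [ey|_]; case: (altP (z =P z0)) => [ez|_].
  + by rewrite ey ez eqxx in ne.
  + by rewrite -setI_eq0 setIUl setU_eq0 !setI_eq0 disjoints1 xF dF.
  + rewrite disjoint_sym -setI_eq0 setIUl setU_eq0 !setI_eq0 disjoints1 xF.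
    by rewrite disjoint_sym dF.
  + exact: dF.
- move=> z; rewrite ffunE; case: ifP => // _.
  by rewrite subUset sub1set xW FW.
- rewrite /fam_size (eq_bigr (fun z => (z == z0) + #|F z|)) //.
  rewrite big_split /= -[X in _ + X]/(fam_size F) sF (bigD1 z0) //= eqxx big1.
    by rewrite addn0.
  by move=> z /negPf ->.
- move=> y z; rewrite !cG; have := bF y z; have := fam_min_le F z.
  rewrite -hz0; have := bF y z0.
  by case: eqP => [->|_]; case: eqP => [->|_]; lia.
Qed.

(** Remove one chosen vertex of each hyperedge. The rest contains no hyperedge, so any equitable
    partition of it is proper. For small eta this gives the product enough vertices. *)
Lemma ecd_le_edges : ecd p H <= #|hedges H|.
Proof.
pose W := [set x : H | [forall e in hedges H, [pick y in e] != Some x]].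
have cW : #|~: W| <= #|hedges H|.
  have /subset_leq_card : [set Some x | x in ~: W] \subset
      [set [pick y in e] | e : {set H} in hedges H].
    apply/subsetP => _ /imsetP [x xW ->]; move: xW; rewrite !inE.
    rewrite negb_forall => /existsP [e]; rewrite negb_imply negbK.
    by case/andP => eH /eqP <-; apply: imset_f.
  rewrite card_imset; last exact: Some_inj.
  by move=> h; apply: leq_trans h _; apply: leq_imset_card.
have [F [dF FW sF bF]] := exists_equitable_family (leqnn #|W|).
have eF : edge_signs F = set0.
  apply/setP => z; rewrite !inE; apply/negbTE; rewrite negb_exists.
  apply/forallP => e; rewrite negb_and; apply/orP.
  have [eH|] := boolP (e \in hedges H); [right|by left].
  apply/negP => /subset_trans /(_ (FW z)) /subsetP eW.
  have [e0|[y ye]] := set_0Vmem e.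
    by move: eH; rewrite e0 (negPf (hedges_neq0 H)).
  case py: [pick y' in e] => [y'|]; last first.
    by move: py; case: pickP => // /(_ y); rewrite ye.
  have y'e : y' \in e by move: py; case: pickP => // w we [<-].
  have := eW _ y'e; rewrite inE => /forall_inP /(_ _ eH).
  by rewrite py eqxx.
have := ecd_balanced_family dF bF eF; rewrite sF.
by have := cardsC W; lia.
Qed.

(** As long as no class contains a hyperedge, [ecd] bounds the level. Afterwards the plain size
    serves: it is at most [#|H|], and the switch goes up because the level never exceeds the
    size. *)
Definition weight F :=
  if edge_signs F == set0 then level F else fam_size F.

Definition wcode F : family := if edge_signs F == set0 then code F else F.

Lemma weight_mono F G : fam_sub F G -> weight F <= weight G.
Proof.
move=> FG; rewrite /weight; case: eqP => eF; case: eqP => eG.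
- exact: level_mono.
- exact: leq_trans (level_le_size F) (fam_size_sub FG).
- by case: eF; apply/eqP; rewrite -subset0 -eG edge_signs_sub.
- exact: fam_size_sub.
Qed.

Lemma weight_rigid F G : fam_sub F G -> weight F = weight G ->
  edge_signs F = edge_signs G /\ wcode F = wcode G.
Proof.
move=> FG; rewrite /weight /wcode; case: eqP => eF; case: eqP => eG.
- by rewrite eF eG => /(level_rigid FG).
(* Here level F <= size F <= size G = level F, so F = G, although only G has edge signs. *)
- move=> eL; have eFG : F = G.
    apply: fam_size_rigid => //; apply/eqP; rewrite eqn_leq fam_size_sub //.
    by rewrite -eL level_le_size.
  by case: eG; rewrite -eFG.
- by case: eF; apply/eqP; rewrite -subset0 -eG edge_signs_sub.
- by move=> /(fam_size_rigid FG) ->.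
Qed.

Lemma edge_signs_shift_eq0 y F :
  (edge_signs (fam_shift y F) == set0) = (edge_signs F == set0).
Proof. by rewrite -!cards_eq0 (card_shift_set (mem_edge_signs_shift y F)). Qed.

Lemma weight_shift y F : weight (fam_shift y F) = weight F.
Proof. by rewrite /weight edge_signs_shift_eq0 level_shift fam_size_shift. Qed.

Lemma wcode_shift y F : wcode (fam_shift y F) = fam_shift y (wcode F).
Proof. by rewrite /wcode edge_signs_shift_eq0 code_shift; case: ifP. Qed.

Lemma wcode_fixed F : fam_shift 1%R (wcode F) = wcode F -> fam_shift 1%R F = F.
Proof. by rewrite /wcode; case: ifP => // _; apply: code_fixed. Qed.

Lemma weight_gt0 F z : F z != set0 -> 0 < weight F.
Proof.
move=> Fz; rewrite /weight; case: ifP => _; first exact: level_gt0 Fz.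
exact: leq_trans (level_gt0 Fz) (level_le_size F).
Qed.

Lemma weight_le F : fam_disjoint F -> weight F <= #|H|.
Proof.
move=> dF; rewrite /weight; case: ifP => _; last exact: fam_size_le.
exact: leq_trans (level_le_size F) (fam_size_le dF).
Qed.

Lemma weight_edge_free F :
  fam_disjoint F -> edge_signs F = set0 -> weight F + ecd p H <= #|H|.
Proof.
by move=> dF eF; rewrite /weight eF eqxx; apply: level_edge_free.
Qed.

End OneHypergraph.

(** * Products of Kneser hypergraphs *)

Section Product.
Variables (q : nat) (p_prime : prime q.+2) (t : nat) (t_gt0 : 0 < t).
Local Notation p := q.+2.
Local Notation Z := 'I_p.
Variables (H : 'I_t -> hypergraph) (C : eqType).
Local Notation G := (cat_product t_gt0 (fun i => KG (prime_gt1 p_prime) (H i))).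
Local Notation E := {i : 'I_t & H i}.
Local Notation svec := {ffun E -> option Z}.
Implicit Types (X Y : svec) (v w : G) (i : 'I_t) (y z : Z).

Definition gcoord v i : {e : {set H i} | e \in hedges (H i)} :=
  (v : {dffun forall i : 'I_t, KG (prime_gt1 p_prime) (H i)}) i.

Lemma gcoord_neq0 v i : val (gcoord v i) != set0.
Proof.
apply: contraNneq (hedges_neq0 (H i)) => <-; exact: valP.
Qed.

Definition block X i : {ffun Z -> {set H i}} :=
  [ffun z => [set x | X (Tagged (fun i => H i : Type) x) == Some z]].

Lemma block_sub X Y i : sv_le X Y -> fam_sub (block X i) (block Y i).
Proof.
move=> /sv_leP XY z; apply/subsetP => x; rewrite !ffunE !inE => /eqP /XY ->.
exact: eqxx.
Qed.

Lemma block_shift y X i : block (sv_shift y X) i = fam_shift y (block X i).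
Proof.
apply/ffunP => z; apply/setP => x; rewrite !ffunE !inE !ffunE.
case: (X _) => //= w; apply/eqP/eqP => [[<-]|[->]].
  by rewrite /zshift addrK.
by rewrite /zshift subrK.
Qed.

Lemma block_disjoint X i : fam_disjoint (block X i).
Proof.
move=> y z ne; rewrite -setI_eq0 -subset0; apply/subsetP => x.
rewrite !ffunE !inE => /andP [/eqP -> /eqP [e]].
by rewrite e eqxx in ne.
Qed.

Lemma block_neq0 X : X != sv0 q E -> exists i, exists z, block X i z != set0.
Proof.
move=> X0; have [e Xe] : exists e, X e != None.
  apply/existsP; apply: contraNT X0 => /existsPn h; apply/eqP/ffunP => e.
  by rewrite ffunE; apply/eqP; have := h e; rewrite negbK.
case: e Xe => i x; case eX: (X _) => [z|] // _; exists i, z.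
by apply/set0Pn; exists x; rewrite ffunE inE; apply/eqP.
Qed.

(** Under invariance a vertex of sign z would also have sign z + 1. *)
Lemma block_fixed X i z :
  fam_shift 1%R (block X i) = block X i -> block X i z = set0.
Proof.
move=> fix1; apply/eqP/set0Pn => -[x xz].
have xz1 : x \in block X i (z + 1)%R by rewrite -fix1 ffunE addrK.
have /eqP := fam_disjoint_eq (@block_disjoint X i) xz xz1.
by rewrite -{1}[z]addr0 (inj_eq (addrI z)) eq_sym oner_eq0.
Qed.

Definition inside X z : {set G} :=
  [set v | [forall i, val (gcoord v i) \subset block X i z]].

Lemma insideP X z v :
  reflect (forall i, val (gcoord v i) \subset block X i z) (v \in inside X z).
Proof. by rewrite inE; apply: forallP. Qed.

Lemma inside_eq X y z v : v \in inside X y -> v \in inside X z -> y = z.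
Proof.
move=> /insideP /(_ (Ordinal t_gt0)) vy /insideP /(_ (Ordinal t_gt0)) vz.
have /set0Pn [x xv] := gcoord_neq0 v (Ordinal t_gt0).
apply: (fam_disjoint_eq (@block_disjoint X _)).
  exact: (subsetP vy _ xv).
exact: (subsetP vz _ xv).
Qed.

(** In each coordinate the p hyperedges lie in different sign classes, so they are disjoint; being
    nonempty they are also distinct, and the projection has exactly p elements. *)
Lemma transversal_edge X (x : Z -> G) :
  (forall z, x z \in inside X z) -> [set x z | z : Z] \in hedges G.
Proof.
move=> xin; rewrite inE; apply/forallP => i.
have dis y z : y != z ->
    [disjoint val (gcoord (x y) i) & val (gcoord (x z) i)].
  move=> ne; apply: disjointW (@block_disjoint X i y z ne).
    exact: (insideP _ _ _ (xin y)).
  exact: (insideP _ _ _ (xin z)).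
have inj : injective (fun z => gcoord (x z) i).
  move=> y z eyz; apply/eqP/negPn/negP => /dis.
  by rewrite eyz -setI_eq0 setIid (negPf (gcoord_neq0 _ _)).
have -> : [set v i | v : {dffun forall i, KG (prime_gt1 p_prime) (H i)} in
    [set x z | z : Z]] = [set gcoord (x z) i | z : Z].
  by rewrite -imset_comp.
rewrite inE card_imset // card_ord eqxx /=.
apply/forall_inP => _ /imsetP [y _ ->]; apply/forall_inP => _ /imsetP [z _ ->].
apply/implyP => ne; apply: dis; apply: contra ne => /eqP ->.
exact: eqxx.
Qed.

Definition asigns X i : {set Z} := edge_signs (block X i).
Definition common X : {set Z} := [set z | [forall i, z \in asigns X i]].

Lemma inside_neq0 X z : z \in common X -> inside X z != set0.
Proof.
rewrite inE => /forallP zA.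
have ex i : exists e : {e : {set H i} | e \in hedges (H i)},
    val e \subset block X i z.
  by have := zA i; rewrite inE => /existsP [e /andP [eH eX]]; exists (Sub e eH).
apply/set0Pn.
exists ([ffun i => xchoose (ex i)] :
  {dffun forall i, KG (prime_gt1 p_prime) (H i)}).
by apply/insideP => i; rewrite /gcoord ffunE; apply: (xchooseP (ex i)).
Qed.

Lemma asigns_shift y X i z :
  (z \in asigns (sv_shift y X) i) = ((z - y)%R \in asigns X i).
Proof. by rewrite /asigns block_shift mem_edge_signs_shift. Qed.

Lemma asigns_sub X Y i : sv_le X Y -> asigns X i \subset asigns Y i.
Proof. by move=> XY; apply/edge_signs_sub/block_sub. Qed.

Lemma card_svec_support : #|{: E}| = \sum_i #|H i|.
Proof. by rewrite card_tagged sumnE big_map big_enum. Qed.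

Variable c : G -> C.
Hypothesis c_proper : proper_coloring c.

(** [C] may be infinite, so a color is encoded by a vertex that has it, the same for all vertices of
    that color. *)
Definition rep v : G := odflt v [pick w | c w == c v].

Lemma c_rep v : c (rep v) = c v.
Proof. by rewrite /rep; case: pickP => //= w /eqP. Qed.

Lemma rep_eq v w : c v = c w -> rep v = rep w.
Proof.
move=> cvw; rewrite /rep (@eq_pick _ _ (fun u => c u == c w)).
  by case: pickP => // /(_ w); rewrite eqxx.
by move=> u; rewrite cvw.
Qed.

Definition colors X : {ffun Z -> {set G}} := [ffun z => rep @: inside X z].

Lemma colors_sub X Y : sv_le X Y -> fam_sub (colors X) (colors Y).
Proof.
move=> XY z; rewrite !ffunE; apply: imsetS; apply/subsetP => v /insideP vX.
by apply/insideP => i; apply: subset_trans (vX i) (block_sub i XY z).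
Qed.

Lemma colors_shift y X : colors (sv_shift y X) = fam_shift y (colors X).
Proof.
apply/ffunP => z; rewrite !ffunE.
suff -> : inside (sv_shift y X) z = inside X (z - y)%R by [].
apply/setP => v; rewrite !inE.
by apply: eq_forallb => i; rewrite block_shift ffunE.
Qed.

(** Properness of [c] enters here: a color of an invariant family occurs at every sign, and one
    vertex of that color per sign gives a monochromatic hyperedge. *)
Lemma colors_not_fixed X :
  common X != set0 -> fam_shift 1%R (colors X) <> colors X.
Proof.
case/set0Pn => z0 /inside_neq0 /set0Pn [v0 v0z] fix1.
have inv z : rep v0 \in colors X z.
  have -> : z = (z0 + ((z - z0)%R : Z)%:R)%R by rewrite natr_Zp addrC subrK.
  elim: (((z - z0)%R : Z) : nat) => [|n IH].
    by rewrite addr0 ffunE imset_f.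
  by rewrite -fix1 ffunE -natr1 addrA addrK.
have ex z : exists v, (v \in inside X z) && (rep v == rep v0).
  have := inv z; rewrite ffunE => /imsetP [v vz ->].
  by exists v; rewrite vz eqxx.
pose x z := xchoose (ex z).
have xP z : x z \in inside X z /\ c (x z) = c v0.
  have /andP [xz /eqP er] := xchooseP (ex z); split=> //.
  by rewrite -c_rep er c_rep.
have /(forall_inP c_proper)/negP : [set x z | z : Z] \in hedges G.
  by apply: (@transversal_edge X) => z; have [] := xP z.
apply; apply/forall_inP => _ /imsetP [y _ ->].
apply/forall_inP => _ /imsetP [z _ ->].
by have [_ ->] := xP y; have [_ ->] := xP z.
Qed.

(** * The level and the sign of a signed vector *)

Variable eta : nat.
Hypothesis eta_le : forall i, eta <= ecd p (H i).
Hypothesis p_le_eta : p <= eta.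

Local Notation N := #|{: E}|.

Definition total X := \sum_i weight (block X i).
(** Without a common sign each of the p signs misses some A_i, so the sum is at most p (t - 1) and
    the total at most [N - eta]. By [N_ge] the subtractions do not truncate. *)
Definition cap X := N - eta - p * t.-1 + \sum_i #|asigns X i|.
Definition lev X :=
  if common X == set0 then minn (total X) (cap X)
  else N - eta + level (colors X).

(** The A_i are transposed, and below the weight codes of all blocks are merged, into one family to
    which [fam_sign] applies. *)
Definition afam X : {ffun Z -> {set 'I_t}} :=
  [ffun z => [set i | z \in asigns X i]].
Definition wfam X : {ffun Z -> {set E}} :=
  [ffun z => [set x : E | tagged x \in wcode (block X (tag x)) z]].
(** The weight provides the sign where it is below the bound, and also where the A_i cannot because
    their family is invariant. *)
Definition use_weight X :=
  (fam_shift 1%R (afam X) == afam X) || (total X < cap X).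

Lemma mem_afam X z i : (i \in afam X z) = (z \in asigns X i).
Proof. by rewrite ffunE in_set. Qed.

Lemma mem_wfam X z (x : E) :
  (x \in wfam X z) = (tagged x \in wcode (block X (tag x)) z).
Proof. by rewrite ffunE in_set. Qed.

Lemma ecd_le_card i : ecd p (H i) <= #|H i|.
Proof.
have := @level_edge_free q (H i) [ffun=> set0].
rewrite /fam_disjoint => h; apply: leq_trans (leq_addl _ _) (h _ _).
  by move=> y z _; rewrite ffunE -setI_eq0 set0I.
apply/setP => z; rewrite !inE; apply/negbTE/existsP => -[e].
rewrite ffunE subset0 => /andP [eH /eqP e0].
by move: eH; rewrite e0 (negPf (hedges_neq0 _)).
Qed.

(** Each of the t blocks has at least [eta] vertices, and [eta] is at least p. *)
Lemma N_ge : eta + p * t.-1 <= N.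
Proof.
have: eta * t.-1.+1 <= N.
  rewrite prednK // card_svec_support.
  rewrite mulnC -[t in t * _]card_ord -sum_nat_const.
  by apply: leq_sum => i _; apply: leq_trans (eta_le i) (ecd_le_card i).
by rewrite mulnS; apply: leq_trans; rewrite leq_add2l leq_mul2r p_le_eta orbT.
Qed.

Lemma cap_le X : common X = set0 -> cap X <= N - eta.
Proof.
move=> X0; suff: \sum_i #|asigns X i| <= p * t.-1.
  by rewrite /cap; have := N_ge; lia.
have -> : \sum_i #|asigns X i| = \sum_z #|afam X z|.
  under eq_bigr do rewrite -sum1_card big_mkcond.
  rewrite exchange_big /=; apply: eq_bigr => z _.
  rewrite -sum1_card [RHS]big_mkcond; apply: eq_bigr => i _.
  by rewrite mem_afam.
rewrite -[p in p * _]card_ord -sum_nat_const; apply: leq_sum => z _.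
have : z \notin common X by rewrite X0 inE.
rewrite inE => /forallPn [i zi].
have /subset_leq_card : afam X z \subset [set~ i].
  by apply/subsetP => j; rewrite mem_afam !in_setC1; apply: contraTneq => ->.
by rewrite cardsC1 card_ord.
Qed.

Lemma total_shift y X : total (sv_shift y X) = total X.
Proof. by apply: eq_bigr => i _; rewrite block_shift weight_shift. Qed.

Lemma cap_shift y X : cap (sv_shift y X) = cap X.
Proof.
congr (_ + _); apply: eq_bigr => i _.
exact: card_shift_set (asigns_shift y X i).
Qed.

Lemma afam_shift y X : afam (sv_shift y X) = fam_shift y (afam X).
Proof.
apply/ffunP => z; apply/setP => i.
by rewrite mem_afam ffunE mem_afam asigns_shift.
Qed.

Lemma wfam_shift y X : wfam (sv_shift y X) = fam_shift y (wfam X).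
Proof.
apply/ffunP => z; apply/setP => x.
by rewrite mem_wfam block_shift wcode_shift !ffunE in_set.
Qed.

Lemma common_shift y X z :
  (z \in common (sv_shift y X)) = ((z - y)%R \in common X).
Proof. by rewrite !inE; apply: eq_forallb => i; rewrite asigns_shift. Qed.

Lemma use_weight_shift y X : use_weight (sv_shift y X) = use_weight X.
Proof.
rewrite /use_weight total_shift cap_shift afam_shift; congr (_ || _).
rewrite fam_shiftD addrC -fam_shiftD; apply/eqP/eqP => [h|->] //.
have K A : fam_shift (- y)%R (fam_shift y A) = A.
  by rewrite fam_shiftD subrr fam_shift0.
by rewrite -[RHS]K -h K.
Qed.

Lemma wfam_not_fixed X : X != sv0 q E -> fam_shift 1%R (wfam X) <> wfam X.
Proof.
move=> /block_neq0 [i [z /eqP Xz]] fix1; apply: Xz; apply: block_fixed.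
apply: wcode_fixed; apply/ffunP => y; apply/setP => x.
move/ffunP: fix1 => /(_ y) /setP /(_ (Tagged (fun i => H i : Type) x)).
by rewrite ffunE !mem_wfam /= => <-; rewrite ffunE.
Qed.

(** Invariance makes each A_i empty or full. Let s count the empty ones; s >= 1 since no sign is
    common. They bound [total X] by N - s eta, while the full ones make [cap X] at least N - eta - p
    (s - 1), and p <= eta. *)
Lemma fixed_total_le X : common X = set0 ->
  fam_shift 1%R (afam X) = afam X -> total X <= cap X.
Proof.
move=> X0 fix1.
have const i y z : (y \in asigns X i) = (z \in asigns X i).
  apply: set_shift_fixed => w.
  by move/ffunP: fix1 => /(_ w) /setP /(_ i); rewrite ffunE !mem_afam.
pose S := [set i | asigns X i == set0].
have [i0 i0S] : exists i, i \in S.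
  have : 0%R \notin common X by rewrite X0 inE.
  rewrite inE => /forallPn [i zi]; exists i; rewrite inE; apply/eqP/setP => z.
  by rewrite in_set0 (const i z 0%R) (negPf zi).
have asS i : i \notin S -> #|asigns X i| = p.
  rewrite in_set => /set0Pn [z zi].
  rewrite -[p in RHS]card_ord -cardsT; congr #|pred_of_set _|.
  by apply/setP => w; rewrite in_setT (const i w z).
have h : total X + eta * #|S| <= N.
  rewrite card_svec_support mulnC -sum_nat_const.
  rewrite [X in _ + X]big_mkcond -big_split /=.
  apply: leq_sum => i _; case: ifP => iS; last first.
    by rewrite addn0 weight_le //; apply: block_disjoint.
  apply: leq_trans (_ : weight (block X i) + ecd p (H i) <= _).
    by rewrite leq_add2l.
  apply: weight_edge_free; first exact: block_disjoint.
  by apply/eqP; rewrite inE in iS.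
have h2 : p * (t - #|S|) <= \sum_i #|asigns X i|.
  have -> : t - #|S| = #|~: S| by have := cardsC S; rewrite card_ord; lia.
  rewrite mulnC -sum_nat_const big_mkcond /=; apply: leq_sum => i _.
  by rewrite inE; case: ifP => // iS; rewrite asS.
have S1 : 0 < #|S| by apply/card_gt0P; exists i0.
have St : #|S| <= t by rewrite -[t in _ <= t]card_ord max_card.
move: h h2 S1 St N_ge; rewrite /cap; move: #|S| => k; nia.
Qed.

Lemma lev_gt0 X : X != sv0 q E -> 0 < lev X.
Proof.
move=> X0; rewrite /lev; case: eqP => [c0|/eqP cn0]; last first.
  have /set0Pn [z zX] := cn0.
  rewrite addn_gt0 (@level_gt0 _ _ (colors X) z) ?orbT //.
  by rewrite ffunE imset_eq0 inside_neq0.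
have T1 : 0 < total X.
  have [i [z Xz]] := block_neq0 X0.
  by rewrite /total (bigD1 i) //= addn_gt0 (weight_gt0 Xz).
rewrite leq_min T1 /=.
have [fx|] := eqVneq (fam_shift 1%R (afam X)) (afam X).
  exact: leq_trans T1 (fixed_total_le c0 fx).
(* If the sum is 0, all A_i are empty and their family is invariant after all. *)
rewrite /cap addn_gt0; case: (posnP (\sum_i _)) => [s0|]; last by rewrite orbT.
case/eqP; apply/ffunP => z; apply/setP => i; rewrite ffunE !mem_afam.
move/eqP: s0; rewrite sum_nat_eq0 => /forallP /(_ i) /=.
rewrite cards_eq0 => /eqP ->.
by rewrite !inE.
Qed.

Section Signs.
Variables (sgG : {ffun Z -> {set G}} -> Z) (sgE : {ffun Z -> {set E}} -> Z)
  (sgA : {ffun Z -> {set 'I_t}} -> Z).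
Hypotheses
  (sgGP : forall y F,
    fam_shift 1%R F <> F -> sgG (fam_shift y F) = (sgG F + y)%R)
  (sgEP : forall y F,
    fam_shift 1%R F <> F -> sgE (fam_shift y F) = (sgE F + y)%R)
  (sgAP : forall y F,
    fam_shift 1%R F <> F -> sgA (fam_shift y F) = (sgA F + y)%R).

Definition vsign X : Z :=
  if common X != set0 then sgG (code (colors X))
  else if use_weight X then sgE (wfam X) else sgA (afam X).

Lemma vsign_shift y X : X != sv0 q E -> vsign (sv_shift y X) = (vsign X + y)%R.
Proof.
move=> X0; rewrite /vsign -cards_eq0.
rewrite (card_shift_set (common_shift y X)) cards_eq0.
rewrite use_weight_shift colors_shift code_shift wfam_shift afam_shift.
case: ifP => [cX|_].
  by apply: sgGP => /code_fixed; apply: colors_not_fixed.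
case: ifP => [_|]; first by apply: sgEP; apply: wfam_not_fixed.
rewrite /use_weight => /negbT; rewrite negb_or => /andP [/eqP nf _].
exact: sgAP.
Qed.

Lemma total_mono X Y : sv_le X Y -> total X <= total Y.
Proof. by move=> XY; apply: leq_sum => i _; apply/weight_mono/block_sub. Qed.

Lemma total_rigid X Y : sv_le X Y -> total X = total Y ->
  (forall i, asigns X i = asigns Y i) /\ wfam X = wfam Y.
Proof.
move=> XY eT.
have ew i : weight (block X i) = weight (block Y i).
  apply/eqP; rewrite eqn_leq weight_mono; last exact: block_sub.
  rewrite leqNgt; apply/negP => lt.
  suff: total X < total Y by rewrite eT ltnn.
  rewrite /total (bigD1 i) //= [X in _ < X](bigD1 i) //= -addSn leq_add //.
  by apply: leq_sum => j _; apply/weight_mono/block_sub.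
have r i := weight_rigid (block_sub i XY) (ew i).
split=> [i|]; first by have [] := r i.
apply/ffunP => z; apply/setP => x; rewrite !mem_wfam.
by have [_ ->] := r (tag x).
Qed.

Lemma cap_mono X Y : sv_le X Y -> cap X <= cap Y.
Proof.
move=> XY; rewrite leq_add2l.
by apply: leq_sum => i _; apply/subset_leq_card/asigns_sub.
Qed.

Lemma cap_rigid X Y : sv_le X Y -> cap X = cap Y ->
  forall i, asigns X i = asigns Y i.
Proof.
move=> XY /eqP; rewrite eqn_add2l => /eqP eS i; apply/eqP.
rewrite eqEcard asigns_sub //= leqNgt; apply/negP => lt.
suff: \sum_i #|asigns X i| < \sum_i #|asigns Y i| by rewrite eS ltnn.
rewrite (bigD1 i) //= [X in _ < X](bigD1 i) //= -addSn leq_add //.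
by apply: leq_sum => j _; apply/subset_leq_card/asigns_sub.
Qed.

Lemma lev_vsign X Y : X != sv0 q E -> sv_le X Y ->
  lev X <= lev Y /\ (lev X = lev Y -> vsign X = vsign Y).
Proof.
move=> X0 XY; rewrite /lev /vsign.
case: (altP (common X =P set0)) => [cX|/set0Pn [z zX]]; last first.
  have cY : common Y != set0.
    apply/set0Pn; exists z; move: zX; rewrite !inE => /forallP zX.
    by apply/forallP => i; apply: (subsetP (asigns_sub i XY)).
  rewrite (negPf cY) /= leq_add2l; split; first exact/level_mono/colors_sub.
  by move/eqP; rewrite eqn_add2l => /eqP /(level_rigid (colors_sub XY)) ->.
(* If a common sign first appears at Y, the level jumps strictly above [N - eta], which bounded it
   at X. *)
case: (altP (common Y =P set0)) => [cY|/set0Pn [z zY]] /=; last first.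
  have L1 : 0 < level (colors Y).
    by apply: (@level_gt0 _ _ _ z); rewrite ffunE imset_eq0 inside_neq0.
  have lt : minn (total X) (cap X) < N - eta + level (colors Y).
    by have := cap_le cX; lia.
  by split=> [|e]; [exact: ltnW | move: lt; rewrite e ltnn].
have TXY := total_mono XY; have CXY := cap_mono XY.
split; first by lia.
move=> em; have [eT|nT] := eqVneq (total X) (total Y).
  (* Equal totals fix the weight codes and the A_i, hence everything that the sign depends on. *)
  have [eA eW] := total_rigid XY eT.
  have eafam : afam X = afam Y.
    by apply/ffunP => w; apply/setP => i; rewrite !mem_afam eA.
  have ecap : cap X = cap Y by congr (_ + _); apply: eq_bigr => i _; rewrite eA.
  by rewrite /use_weight eafam ecap eT eW.
(* The total grows, so the equal minima are both the bound, and the A_i stay constant. *)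
have geX : cap X <= total X by lia.
have ecap : cap X = cap Y by lia.
have eA := cap_rigid XY ecap.
have eafam : afam X = afam Y.
  by apply/ffunP => w; apply/setP => i; rewrite !mem_afam eA.
(* Otherwise total Y <= cap Y = cap X <= total X, although the total has grown. *)
have nu : fam_shift 1%R (afam Y) != afam Y.
  by apply/eqP => /(fixed_total_le cY); lia.
rewrite /use_weight eafam (negPf nu) /=.
by rewrite !ltnNge geX -ecap (leq_trans geX TXY) /=.
Qed.

End Signs.

Lemma exists_many_colors : exists X, eta <= level (colors X).
Proof.
have [sgG sgGP] := @fam_sign q G p_prime.
have [sgE sgEP] := @fam_sign q E p_prime.
have [sgA sgAP] := @fam_sign q 'I_t p_prime.
have N1 : 0 < N by have := N_ge; lia.
have [X _ NX] : exists2 X, X != sv0 q E & N <= lev X.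
  exact: exists_high_level N1 (vsign_shift sgGP sgEP sgAP) lev_gt0
    (lev_vsign sgG sgE sgA).
have etaN : eta <= N := leq_trans (leq_addr _ _) N_ge.
(* Without a common sign the level would be at most [N - eta], which is less than N. *)
exists X; move: NX; rewrite /lev; case: eqP => [/cap_le|_]; first by lia.
by rewrite -leq_subLR subKn.
Qed.

Lemma exists_colorful_large : exists V : Z -> {set G},
  colorful_balanced_complete_partite c eta V.
Proof.
have [X hX] := exists_many_colors.
have [F [FX sF bF]] := balanced_subfamily hX.
(* A representative r need not lie in [inside X z]; a vertex there of the same color replaces it. *)
pose pre z r := odflt r [pick v in inside X z | rep v == r].
have preP z r : r \in F z -> pre z r \in inside X z /\ rep (pre z r) = r.
  move=> /(subsetP (FX z)); rewrite ffunE => /imsetP [v vX ->].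
  rewrite /pre; case: pickP => [w /andP [wX /eqP ew] //|/(_ v)].
  by rewrite vX eqxx.
pose V z := pre z @: F z.
have VX z v : v \in V z -> v \in inside X z.
  by case/imsetP => r /preP [rX _] ->.
have cV z : #|V z| = #|F z|.
  apply: card_in_imset => r r' /preP [_ er] /preP [_ er'] e.
  by rewrite -er -er' e.
exists V; split.
- move=> y z ne; rewrite -setI_eq0 -subset0; apply/subsetP => v.
  rewrite in_setI => /andP [/VX vy /VX vz].
  by rewrite (inside_eq vy vz) eqxx in ne.
- by rewrite -sF; apply: eq_bigr => z _.
- by move=> y z; rewrite !cV.
- move=> e ce eV.
  have ex z : exists v, v \in e :&: V z.
    by apply/set0Pn; rewrite -card_gt0 eV.
  pose x z := xchoose (ex z).
  have xP z : x z \in e /\ x z \in inside X z.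
    have := xchooseP (ex z); rewrite in_setI => /andP [? /VX]; by split.
  have xinj : injective x.
    move=> y z exyz; have [_ xy] := xP y; have [_ xz] := xP z.
    by rewrite exyz in xy; apply: inside_eq xy xz.
  have <- : [set x z | z : Z] = e.
    apply/eqP; rewrite eqEcard card_imset // card_ord ce leqnn andbT.
    by apply/subsetP => _ /imsetP [z _ ->]; have [] := xP z.
  by apply: (@transversal_edge X) => z; have [] := xP z.
- move=> z v w /imsetP [r rF ->] /imsetP [r' r'F ->] /rep_eq.
  by have [_ ->] := preP _ _ rF; have [_ ->] := preP _ _ r'F => ->.
Qed.

End Product.

(** * Fewer than p vertices, and the conclusion *)

Lemma colorful_singletons (G : hypergraph) (C : eqType) (c : G -> C) p n :
  n < p -> n <= #|G| ->
  exists V : 'I_p -> {set G}, colorful_balanced_complete_partite c n V.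
Proof.
move=> np nG.
(* The i-th vertex alone for i < n, and empty from n on. As n < p, the part of index n is empty and
   no transversal exists. *)
pose V (i : 'I_p) : {set G} := [set x in take 1 (drop i (take n (enum G)))].
have szG : size (take n (enum G)) = n.
  rewrite size_take -cardE; case: ltnP => // ?.
  by apply/eqP; rewrite eqn_leq nG andbT.
have VE (i : 'I_p) : n <= i -> V i = set0.
  by move=> ni; apply/setP => x; rewrite !inE drop_oversize ?szG.
have VS (i : 'I_p) x : x \in V i -> i < n /\ x = nth x (take n (enum G)) i.
  rewrite inE; case: (ltnP i n) => ni; last by rewrite drop_oversize ?szG.
  by rewrite (drop_nth x) ?szG //= take0 inE => /eqP {1}->.
have cV (i : 'I_p) : #|V i| = (i < n).
  case: ltnP => ni; last by rewrite VE // cards0.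
  have /card_gt0P [x0 _] : 0 < #|G|.
    exact: leq_trans (leq_ltn_trans (leq0n _) ni) nG.
  by rewrite /V (drop_nth x0) ?szG //= take0 cardsE (card_uniqP _).
exists V; split.
- move=> i j; apply: contraNT.
  move=> /pred0Pn [x /= /andP [/VS [ni xi] /VS [nj xj]]].
  apply/eqP/val_inj/eqP.
  rewrite -(nth_uniq x _ _ (take_uniq n (enum_uniq G))) ?szG //.
  by rewrite -xi -xj.
- rewrite (eq_bigr (fun i : 'I_p => (i < n : nat))) //.
  rewrite -(big_mkord predT (fun i => (i < n : nat))) -(subnKC (ltnW np)).
  rewrite /index_iota subn0 iotaD big_cat /= -{1}[n]subn0 -/(index_iota 0 n).
  rewrite big_nat (eq_bigr (fun=> 1)) => [|i /andP [_ ->]] //.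
  rewrite -big_nat sum_nat_const_nat subn0 muln1 big1_seq ?addn0 //.
  by move=> i; rewrite mem_iota => /andP [_ /andP [ni _]]; rewrite ltnNge ni.
- by move=> i j; rewrite !cV; case: (i < n); case: (j < n).
- by move=> e _ /(_ (Ordinal np)); rewrite VE // setI0 cards0.
- move=> i x y /VS [ni xi] /VS [_ yi] _.
  by rewrite xi yi; apply: set_nth_default; rewrite szG.
Qed.

Lemma min_ecd_le p t (t_gt0 : 0 < t) (H : 'I_t -> hypergraph) i :
  min_ecd p t_gt0 H <= ecd p (H i).
Proof.
rewrite /min_ecd; move: (index_enum _) (mem_index_enum i) => r.
elim: r => //= j r IH.
rewrite big_cons inE => /orP [/eqP <-|/IH]; first exact: geq_minl.
by apply: leq_trans; apply: geq_minr.
Qed.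

Theorem theorem1 (p : nat) (p_prime : prime p) (t : nat) (t_gt0 : 0 < t)
    (H : 'I_t -> hypergraph) (C : eqType)
    (c : cat_product t_gt0 (fun i => KG (prime_gt1 p_prime) (H i)) -> C)
    (c_proper : proper_coloring c) :
  exists V : 'I_p -> {set cat_product t_gt0 (fun i => KG (prime_gt1 p_prime) (H i))},
    colorful_balanced_complete_partite c (min_ecd p t_gt0 H) V.
Proof.
(* In the form [q.+2] the signs ['I_p] carry the ring structure of Z/p. *)
case: p p_prime c c_proper => [|[|q]] // p_prime c c_proper.
have le_ecd := min_ecd_le q.+2 t_gt0 H.
have [eta_ge|eta_lt] := leqP q.+2 (min_ecd q.+2 t_gt0 H).
  exact: (exists_colorful_large c_proper le_ecd eta_ge).
(* It remains to find [min_ecd] vertices in the product: each factor has that many, by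
   [ecd_le_edges], and if this number is positive the other factors do not make the product
   smaller. *)
apply: colorful_singletons => //.
have [->//|eta_gt0] := posnP (min_ecd q.+2 t_gt0 H).
have cardG : #|cat_product t_gt0 (fun i => KG (prime_gt1 p_prime) (H i))| =
    foldr muln 1 [seq #|KG (prime_gt1 p_prime) (H i)| | i : 'I_t].
  exact: card_dep_ffun.
have factor_ge i : min_ecd q.+2 t_gt0 H <= #|KG (prime_gt1 p_prime) (H i)|.
  by rewrite card_sig; apply: leq_trans (le_ecd i) (ecd_le_edges q (H i)).
have : enum 'I_t != [::] by rewrite -size_eq0 size_enum_ord -lt0n.
rewrite cardG /image_mem; elim: (enum 'I_t) => //= i r IH _.
case: r IH => [|j r] IH; first by rewrite muln1 factor_ge.
apply: leq_trans (factor_ge i) _.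
by rewrite leq_pmulr // (leq_trans eta_gt0) ?IH.
Qed.
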